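(* If $k$ is an integer such that $2k+1=2^n-1$ for some integer $n\ge 2$, then $\chi(K^2(2k+1,k))\le 2k+2$.
   Context: For integers $m\ge 2k$, the Kneser graph $K(m,k)$ is the graph whose vertices are the $k$-element subsets of a fixed $m$-element set, two vertices $A,B$ being adjacent if and only if $A\cap B=\emptyset$. The square $G^2$ of a simple graph $G$ has vertex set $V(G)$, and two distinct vertices are adjacent in $G^2$ if and only if their distance in $G$ is at most $2$. $K^2(m,k)$ denotes the square of $K(m,k)$, and $\chi$ denotes the chromatic number. *)

(* Defs.v *)
From mathcomp Require Import all_boot.

Set Implicit Arguments.
Unset Strict Implicit.
Unset Printing Implicit Defensive.

Record sgraph := SGraph {
  vertex :> finType;
  adj : rel vertex;
  adj_sym : symmetric adj;
  adj_irrefl : irreflexive adj }.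

Section Graphs.
Variable G : sgraph.

Definition has_walk (d : nat) (u v : G) : bool :=
  [exists p : d.-tuple G, path (@adj G) u p && (last u p == v)].

(* A relation rather than a nat-valued function: vertices in different
   components are at no finite distance. *)
Definition at_dist (d : nat) (u v : G) : bool :=
  has_walk d u v && [forall i : 'I_d, ~~ has_walk i u v].

Lemma has_walk_sym d : symmetric (has_walk d).
Proof.
suff H u v : has_walk d u v -> has_walk d v u by move=> u v; apply/idP/idP; apply: H.
case/existsP=> p /andP[pp /eqP lp].
have sz : size (rev (belast u p)) == d by rewrite size_rev size_belast size_tuple.
apply/existsP; exists (Tuple sz) => /=; apply/andP; split.
  rewrite -lp rev_path; apply: sub_path pp => x y.
  by rewrite adj_sym.
case: (tval p) lp => [|x s] /= lp; first by rewrite lp.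
by rewrite rev_cons last_rcons.
Qed.

Lemma at_dist_sym d : symmetric (at_dist d).
Proof.
move=> u v; rewrite /at_dist has_walk_sym; congr (_ && _).
by apply: eq_forallb => i; rewrite has_walk_sym.
Qed.

Definition square_adj : rel G :=
  fun u v => (u != v) && [exists d : 'I_3, at_dist d u v].

Lemma square_adj_sym : symmetric square_adj.
Proof.
move=> u v; rewrite /square_adj eq_sym; congr (_ && _).
by apply: eq_existsb => d; rewrite at_dist_sym.
Qed.

Lemma square_adj_irrefl : irreflexive square_adj.
Proof. by move=> u; rewrite /square_adj eqxx. Qed.

Definition square : sgraph := SGraph square_adj_sym square_adj_irrefl.

Definition colorable (c : nat) : bool :=
  [exists f : {ffun G -> 'I_c}, forall u, forall v, adj u v ==> (f u != f v)].

Lemma colorable_exists : exists c, colorable c.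
Proof.
exists #|G|; apply/existsP; exists [ffun u => enum_rank u].
apply/forallP=> u; apply/forallP=> v; apply/implyP=> uv.
rewrite !ffunE; apply: contraTneq uv => /enum_rank_inj ->.
by rewrite adj_irrefl.
Qed.

Definition chromatic_number : nat := ex_minn colorable_exists.

End Graphs.

Section Kneser.
Variables m k : nat.

Definition kneser_vertex : finType := {A : {set 'I_m} | #|A| == k}.

(* For k > 0 disjoint vertices are automatically distinct; the first conjunct
   only removes the loop at the empty set when k = 0. *)
Definition kneser_adj : rel kneser_vertex :=
  fun A B => (A != B) && [disjoint val A & val B].

Lemma kneser_adj_sym : symmetric kneser_adj.
Proof. by move=> A B; rewrite /kneser_adj eq_sym disjoint_sym. Qed.

Lemma kneser_adj_irrefl : irreflexive kneser_adj.
Proof. by move=> A; rewrite /kneser_adj eqxx. Qed.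

Definition kneser : sgraph := SGraph kneser_adj_sym kneser_adj_irrefl.

End Kneser.

(* Main.v *)
Require Import Defs.
From mathcomp Require Import all_boot.
From mathcomp Require Import all_algebra.

(** Identify the ground set with the nonzero vectors of F_2^n and colour a
    k-set by the sum of its elements. Two k-sets at distance 2 lie in a common
    (k+1)-set, so their sums differ by two distinct vectors. Two disjoint k-sets
    miss exactly one element c; as the nonzero vectors of F_2^n sum to 0 when
    n >= 2, the two sums differ by c <> 0. *)

Import GRing.Theory.

Lemma colorable_chromatic_number (G : sgraph) (c : nat) :
  colorable G c -> chromatic_number G <= c.
Proof. by move=> Gc; rewrite /chromatic_number; case: ex_minnP => m _; apply. Qed.

(** A walk of length at most 2 joins [u] to [v], and [u != v] excludes length 0. *)
Lemma square_adj_cases (G : sgraph) (u v : G) : square_adj u v ->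
  adj u v \/ u != v /\ exists w, adj u w && adj w v.
Proof.
case/andP=> uv /existsP[[d d_lt3]] /= /andP[/existsP[p] /andP[pp /eqP lp] _].
case: p pp lp => s /= /eqP sz pp lp; rewrite -sz in d_lt3.
move: pp lp uv d_lt3; case: s {sz} => [|x [|y []]] //=.
- by move=> _ ->; rewrite eqxx.
- by rewrite andbT => ux <-; left.
- by rewrite andbT => uxy <- uy; right; split=> //; exists x.
Qed.

Lemma subset_card_succ (T : finType) (A D : {set T}) :
  A \subset D -> #|D| = #|A|.+1 -> exists2 a, a \notin A & D = a |: A.
Proof.
move=> sAD cD.
have /cards1P[a Da] : #|D :\: A| == 1 by rewrite cardsDS // cD subSnn.
exists a.
  by have := set11 a; rewrite -Da inE => /andP[].
by rewrite -[LHS](setID D A) (setIidPr sAD) Da setUC.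
Qed.

Lemma sum_rV_F2 (n : nat) : 2 <= n -> (\sum_(v : 'rV['F_2]_n) v = 0)%R.
Proof.
move=> n_ge2; apply/rowP=> i; rewrite summxE mxE.
(* Here [2 <= n] is essential: for [n = 1] the sum is 1. *)
have [j ji] : exists j : 'I_n, j != i.
  apply/existsP; rewrite -negb_forall; apply: contraL n_ge2 => /forallP i_all.
  rewrite -leqNgt -[n]card_ord -(card1 i); apply: subset_leq_card.
  by apply/subsetP=> j _; apply: i_all.
(* Translation by the j-th basis vector is an involution that fixes the i-th
   coordinate, so the terms cancel in pairs. *)
pose t (v : 'rV['F_2]_n) := (v + delta_mx 0 j)%R.
have F2D (x : 'F_2) : (x + x = 0)%R by apply: addrr_pchar2.
have tK : involutive t.
  by move=> v; apply/rowP=> l; rewrite !mxE -addrA F2D addr0.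
(* Reindexing by [t] carries the half with nonzero [j]-th coordinate to the other half, so the sum
   becomes [x + x]. *)
rewrite (bigID (fun v : 'rV['F_2]_n => v ord0 j == 0%R)) /=.
rewrite [X in (_ + X)%R](reindex_inj (inv_inj tK)) /=.
rewrite [X in (_ + X)%R](eq_big (fun v : 'rV['F_2]_n => v ord0 j == 0%R)
  (fun v : 'rV['F_2]_n => v ord0 i)) ?F2D // => v.
  rewrite !mxE !eqxx /=.
  by move: (v ord0 j); case=> [[|[|]]].
by rewrite !mxE (eq_sym i) (negbTE ji) andbF addr0.
Qed.

(** The colour of a set is the sum of its labels [e i] in [V]. Injectivity of [e] separates sets at
    distance 2; nonzero labels with zero total separate disjoint sets. *)
Lemma square_kneser_colorable (V : finZmodType) (k : nat)
    (e : 'I_(2 * k + 1) -> V) :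
    (forall x : V, x + x = 0)%R -> injective e -> (forall i, e i != 0%R) ->
    (\sum_i e i = 0)%R ->
  colorable (square (kneser (2 * k + 1) k)) #|V|.
Proof.
move=> V2 e_inj e_neq0 e_sum0.
pose s (A : {set 'I_(2 * k + 1)}) := (\sum_(i in A) e i)%R.
have sU1 a (A : {set 'I_(2 * k + 1)}) : a \notin A -> s (a |: A) = (e a + s A)%R by apply: big_setU1.
apply/existsP; exists [ffun A : kneser_vertex _ _ => enum_rank (s (val A))].
apply/forallP=> A; apply/forallP=> B; apply/implyP=> /square_adj_cases AB.
rewrite !ffunE (inj_eq enum_rank_inj); apply/negP=> /eqP sAB.
have /eqP cA := valP A; have /eqP cB := valP B.
case: AB => [/andP[_ dAB] | [AB [C /andP[/andP[_ dAC] /andP[_ dCB]]]]].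
  have cU : #|val A :|: val B| = 2 * k.
    by rewrite cardsU disjoint_setI0 // cards0 subn0 cA cB mul2n addnn.
  have [|c c_notin Tc] := subset_card_succ _ _ _ (subsetT (val A :|: val B)).
    by rewrite cardsT card_ord cU addn1.
  have sU : s (val A :|: val B) = (s (val A) + s (val B))%R.
    by rewrite /s -bigU //; apply: eq_bigl => i; rewrite !inE.
  have sT : s setT = 0%R.
    by rewrite -[RHS]e_sum0; apply: eq_bigl => i; rewrite inE.
  (* Equal colours cancel in characteristic 2, so the zero total would equal [e c]. *)
  have := e_neq0 c; rewrite -sT Tc sU1 // sU sAB V2 addr0.
  by rewrite eqxx.
(* Distance 2: the complement of the common neighbour [C] has [k.+1] elements and contains both
   sets. *)
have /eqP cC := valP C.
have cD : #|~: val C| = k.+1.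
  by rewrite cardsCs setCK card_ord cC mul2n -addnn addn1 -addSn addnK.
have [||a aA Da] := subset_card_succ _ (val A) (~: val C).
- by rewrite subsets_disjoint setCK.
- by rewrite cA.
have [||b bB Db] := subset_card_succ _ (val B) (~: val C).
- by rewrite subsets_disjoint setCK disjoint_sym.
- by rewrite cB.
(* Both [e a + s A] and [e b + s B] are the sum over the complement of [C], so equal colours give
   [e a = e b]. *)
have ab : a = b.
  by apply/e_inj/(addIr (s (val A))); rewrite -sU1 // -Da Db sU1 // sAB.
case/eqP: AB; apply: val_inj.
by rewrite /= -(setU1K aA) -Da Db ab setU1K.
Qed.

Theorem corollary2p6 (k n : nat) (hn : 2 <= n) (hk : 2 * k + 1 = 2 ^ n - 1) :
  chromatic_number (square (kneser (2 * k + 1) k)) <= 2 * k + 2.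
Proof.
pose V := 'rV['F_2]_n.
have cV : #|V| = 2 * k + 2.
  by rewrite card_mx card_Fp // mul1n -(subnK (expn_gt0 2 n)) -hk -addnA.
pose S := [set~ (0 : V)%R].
have cS : 2 * k + 1 = #|S| by rewrite cardsC1 cV addn2 addn1.
pose e (i : 'I_(2 * k + 1)) : V := enum_val (cast_ord cS i).
apply: colorable_chromatic_number; rewrite -cV.
apply: (square_kneser_colorable _ _ e).
- by move=> x; apply/rowP=> i; rewrite !mxE; apply: addrr_pchar2.
- by move=> i j /enum_val_inj/cast_ord_inj.
- by move=> i; have := enum_valP (cast_ord cS i); rewrite !inE.
(* The zero vector adds nothing, so the sum over all of [V] is the sum over [S], which [e]
   enumerates. *)
rewrite -[RHS](sum_rV_F2 n hn) [RHS](bigD1 (0 : V)%R) //= add0r.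
rewrite [RHS](eq_bigl (fun v => v \in S)) => [|v]; last by rewrite !inE.
rewrite [RHS]big_enum_val [RHS](reindex (cast_ord cS)) //=.
by exists (cast_ord (esym cS)) => i _; rewrite ?cast_ordK ?cast_ordKV.
Qed.
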